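(* Let $\Pi$ be the cobweb poset designated by a sequence $\{F_n\}_{n\ge 0}$ of natural numbers with $F_0=1$ (or exceptionally $F_0=0$). Let $k,n\in\mathbb{N}_0$ and $s\in\mathbb{N}$. Then, as functions of the type $(k,n)$: \begin{enumerate} \item $\zeta(k,n)=1$ if $k\le n$, and $\zeta(k,n)=0$ if $k>n$; \item $\zeta^2(k,n)=\left(\sum_{i=k+1}^{n-1}F_i\right)+2$ if $k\le n$, and $\zeta^2(k,n)=0$ if $k>n$; \item $\eta(k,n)=1$ if $k<n$, and $\eta(k,n)=0$ if $k\ge n$; \item $\eta^2(k,n)=\sum_{i=k+1}^{n-1}F_i$ if $k\le n$, and $\eta^2(k,n)=0$ if $k>n$; \item $\eta^s(k,n)=\sum_{k<i_1<\dots<i_{s-1}<n}F_{i_1}F_{i_2}\cdots F_{i_{s-1}}$ if $k\le n$, and $\eta^s(k,n)=0$ if $k>n$; \item $\mathcal{C}(k,n)=1$ if $k=n$, $\mathcal{C}(k,n)=-1$ if $k<n$, and $\mathcal{C}(k,n)=0$ if $k>n$; \item $\chi(k,n)=\delta(k+1,n)$; \item $\chi^s(k,n)=\delta(k+s,n)\cdot F_{k+1}F_{k+2}\cdots F_{n-1}$; \item $\mu(k,n)=(-1)^{n-k}\prod_{i=k+1}^{n-1}(F_i-1)$ if $k\le n$, and $\mu(k,n)=0$ if $k>n$. \end{enumerate}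
   Context: $\mathbb{N}_0=\mathbb{N}\cup\{0\}$. Cobweb poset: for $s\in\mathbb{N}_0$ let $\Phi_s=\{\langle j,s\rangle : 1\le j\le F_s\}$ (in the exceptional case $F_0=0$, the level $\Phi_0$ is a one-element set consisting of an empty root). Then $\Pi=(V,\le)$ with $V=\bigcup_{s\ge 0}\Phi_s$ and, for $x=\langle s,t\rangle$, $y=\langle u,v\rangle$: $x\le y$ iff $t<v$ or ($t=v$ and $s=u$). The rank function is $r(x)=s$ for $x\in\Phi_s$. For $x\le y$ the segment is $[x,y]=\{z\in\Pi: x\le z\le y\}$; $S(\Pi)$ is the set of all segments. $I(\Pi)$ is the incidence algebra of $\Pi$ over an associative ring with identity (functions $f(x,y)$ vanishing unless $x\le y$, with product $(f\ast g)(x,y)=\sum_{x\le z\le y}f(x,z)g(z,y)$ and identity the Kronecker delta $\delta(x,y)$); powers are taken with respect to $\ast$. For $k\le n$, $(k,n)=\{[x,y]\in S(\Pi): r(x)=k,\ r(y)=n\}$, and $(k,n)=\emptyset$ for $k>n$. For each of the functions $f$ below and their powers, $f(k,n)$ denotes the common value $f(x,y)$ for $[x,y]\in(k,n)$, and is $0$ when $k>n$. The functions are: $\zeta(x,y)=1$ if $x\le y$ and $0$ otherwise; $\mu=\zeta^{-1}$ (the Möbius function); $\eta=\zeta-\delta$, so $\eta(x,y)=1$ if $x<y$ and $0$ otherwise; $\mathcal{C}=\delta-\eta$; and $\chi(x,y)=\delta(r(x)+1,r(y))$, i.e. $1$ if $y$ covers $x$ and $0$ otherwise. On integers, $\delta(a,b)$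 is the Kronecker delta. Empty sums are $0$ and empty products are $1$.
   Formalization: In item 2 the formula for ζ²(k,n) is stated for k < n only; at k = n the value is corrected from 2 to 1, since [x,x] = {x} gives ζ²(x,x) = 1. *)

(* Defs.v *)
From HB Require Import structures.
From mathcomp Require Import all_boot all_order all_algebra.

Set Implicit Arguments.
Unset Strict Implicit.
Unset Printing Implicit Defensive.

Import Order.TTheory GRing.Theory.

Local Open Scope ring_scope.

(* The level of rank 0 is a single root even in the exceptional case
   F 0 = 0.                                                                 *)
Definition level_size (F : nat -> nat) (s : nat) : nat :=
  if (s == 0) && (F 0 == 0) then 1 else F s.

(* The vertex <j, s> has coords (j, s). *)
Record cobweb (F : nat -> nat) := Vertex {
  coords : nat * nat;
  _ : (1 <= coords.1 <= level_size F coords.2)%N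
}.

HB.instance Definition _ F := [isSub for @coords F].
HB.instance Definition _ F := [Countable of cobweb F by <:].

Section Cobweb.
Variable F : nat -> nat.

Definition rank (x : cobweb F) : nat := (coords x).2.

Definition cobweb_le (x y : cobweb F) : bool :=
  (rank x < rank y)%N
  || (rank x == rank y) && ((coords x).1 == (coords y).1).

Lemma cobweb_leE x y : cobweb_le x y = (rank x < rank y)%N || (x == y).
Proof. by rewrite /cobweb_le -val_eqE andbC -pair_eqE. Qed.

Fact cobweb_le_refl : reflexive cobweb_le.
Proof. by move=> x; rewrite cobweb_leE eqxx orbT. Qed.

Fact cobweb_le_anti : antisymmetric cobweb_le.
Proof.
move=> x y; rewrite !cobweb_leE => /andP[/orP[xy|/eqP//] /orP[yx|/eqP//]].
by have := ltn_trans xy yx; rewrite ltnn.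
Qed.

Fact cobweb_le_trans : transitive cobweb_le.
Proof.
move=> y x z; rewrite !cobweb_leE => /orP[xy|/eqP->//] /orP[yz|/eqP<-].
  by rewrite (ltn_trans xy yz).
by rewrite xy.
Qed.

End Cobweb.

Fact cobweb_display : Order.disp_t. Proof. exact: (Order.Disp tt tt). Qed.

HB.instance Definition _ F :=
  Order.Le_isPOrder.Build cobweb_display (cobweb F)
    (@cobweb_le_refl F) (@cobweb_le_anti F) (@cobweb_le_trans F).

Section Segment.
Variable F : nat -> nat.
Implicit Types x y z : cobweb F.

(* The vertices of rank at most n; every z <= y has rank at most rank y, so
   that filtering this enumeration yields the whole segment (mem_segment).  *)
Definition vertices_upto (n : nat) : seq (cobweb F) :=
  pmap insub [seq (j, t) | t <- iota 0 n.+1, j <- iota 1 (level_size F t)].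

Definition segment x y : seq (cobweb F) :=
  [seq z <- vertices_upto (rank y) | (x <= z <= y)%O].

Lemma mem_vertices_upto n z : (z \in vertices_upto n) = (rank z <= n)%N.
Proof.
rewrite mem_pmap_sub; apply/allpairsPdep/idP => [[t [j [+ _ ez]]]|zn].
  by rewrite mem_iota add0n ltnS /rank -[coords z]/(val z) ez.
exists (rank z), (coords z).1; rewrite !mem_iota add0n !ltnS zn.
by split; [|exact: valP z|rewrite /rank -surjective_pairing].
Qed.

Lemma mem_segment x y z : (z \in segment x y) = (x <= z <= y)%O.
Proof.
rewrite mem_filter mem_vertices_upto andb_idr // => /andP[_].
by rewrite [(z <= y)%O]cobweb_leE => /orP[/ltnW|/eqP->].
Qed.

Lemma segment_uniq x y : uniq (segment x y).
Proof.
apply/filter_uniq/pmap_sub_uniq/allpairs_uniq_dep => [|t _|].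
- exact: iota_uniq.
- exact: iota_uniq.
by move=> [t j] [t' j'] _ _ /= [-> ->].
Qed.

End Segment.

Section IncidenceAlgebra.
Variables (R : pzRingType) (F : nat -> nat).
Implicit Types (f g : cobweb F -> cobweb F -> R) (x y z : cobweb F).

Definition incidence f : Prop := forall x y, ~~ (x <= y)%O -> f x y = 0.

Definition conv f g x y : R := \sum_(z <- segment x y) f x z * g z y.

Definition delta x y : R := (x == y)%:R.

Definition conv_pow f (s : nat) : cobweb F -> cobweb F -> R :=
  iter s (conv f) delta.

Definition conv_inverse f g : Prop :=
  [/\ incidence g, conv f g =2 delta & conv g f =2 delta].

Definition zeta x y : R := (x <= y)%O%:R.
Definition eta x y : R := zeta x y - delta x y.
Definition calC x y : R := delta x y - eta x y.
Definition chi x y : R := ((rank x).+1 == rank y)%:R.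

(* [x, y] is a segment of the type (k, n). *)
Definition of_type (k n : nat) x y : bool :=
  [&& (x <= y)%O, rank x == k & rank y == n].

(* f(k, n) is defined and equal to v: for k <= n, the type (k, n) is inhabited
   and v is the common value of f on its segments; for k > n, f(k, n) is 0 by
   convention.                                                              *)
Definition type_value f (k n : nat) (v : R) : Prop :=
  if (k <= n)%N then
    (exists x y, of_type k n x y) /\ (forall x y, of_type k n x y -> f x y = v)
  else v = 0.

End IncidenceAlgebra.

Arguments delta R F x y : clear implicits.
Arguments zeta R F x y : clear implicits.
Arguments eta R F x y : clear implicits.
Arguments calC R F x y : clear implicits.
Arguments chi R F x y : clear implicits.

(* Main.v *)
(** All vertices of rank strictly between those of x < y lie in [x, y], so a
    segment sum of a function of the rank is a sum over ranks weighted by the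
    level sizes.  Convolution therefore preserves functions whose value at
    x < y depends only on the two ranks, and each power obeys a one-variable
    recurrence.  For the Moebius function the recurrence telescopes, because
    replacing n by n + 1 multiplies the claimed value by 1 - F n. *)

Require Import Defs.
From mathcomp Require Import all_boot all_order all_algebra.
Import Order.TTheory GRing.Theory.
Local Open Scope ring_scope.

Section RankedFunctions.
Set Implicit Arguments.
Unset Strict Implicit.
Context {R : pzRingType} {F : nat -> nat}.
Implicit Types (x y z : cobweb F) (f g : cobweb F -> cobweb F -> R).
Implicit Types (u v : nat -> nat -> R) (k n s : nat).

(** * Segment sums and convolution *)

Lemma cobweb_ltE x y : (x < y)%O = (rank x < rank y)%N.
Proof.
rewrite lt_neqAle [(x <= y)%O]cobweb_leE.
by case: (x =P y) => [->|_]; rewrite ?ltnn ?orbF.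
Qed.

Lemma segmentxx x : segment x x = [:: x].
Proof.
apply/perm_small_eq => //; apply: uniq_perm; rewrite ?segment_uniq // => z.
by rewrite mem_segment inE eq_sym eq_le.
Qed.

Lemma sum_vertices_upto n (P : pred nat) (a : nat -> R) :
  \sum_(z <- vertices_upto F n | P (rank z)) a (rank z) =
  \sum_(0 <= i < n.+1 | P i) a i *+ level_size F i.
Proof.
rewrite -(big_map val (fun p => P p.2) (fun p => a p.2)) /vertices_upto.
rewrite (pmap_filter (insubK _)) big_filter_cond.
rewrite big_mkcond big_allpairs_dep /= /index_iota subn0 [RHS]big_mkcond.
apply: eq_bigr => i _; rewrite -big_mkcond /= big_seq_cond.
(* [insub] succeeds exactly on the enumerated coordinates, so a level contributes one constant, once
   per vertex. *)
rewrite (eq_bigl (fun j => (j \in iota 1 (level_size F i)) && P i)).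
  case: (P i); last by rewrite big_pred0 // => j; rewrite andbF.
  under eq_bigl do rewrite andbT.
  by rewrite -big_seq big_const_seq count_predT size_iota iter_addr_0.
move=> j; rewrite mem_iota add1n ltnS isSome_insub /=.
by case: (1 <= j <= _)%N.
Qed.

(** The end points stand apart because there one factor of a convolution is a diagonal value; in
    between, all vertices of a level contribute alike. *)
Lemma sum_segment x y (b : cobweb F -> R) (a : nat -> R) : (x < y)%O ->
    (forall z, (x < z < y)%O -> b z = a (rank z)) ->
  \sum_(z <- segment x y) b z =
  b x + \sum_((rank x).+1 <= i < rank y) a i *+ F i + b y.
Proof.
move=> xy ba; set s := [seq z <- segment x y | (x < z < y)%O].
have xs : x \notin s by rewrite mem_filter ltxx.
have ys : y \notin s by rewrite mem_filter ltxx andbF.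
have Es : perm_eq (segment x y) [:: x, y & s].
  apply: uniq_perm; first exact: segment_uniq.
    by rewrite /= inE negb_or xs ys (lt_eqF xy) filter_uniq ?segment_uniq.
  move=> z; rewrite mem_segment !inE mem_filter mem_segment.
  rewrite [(x <= z)%O]le_eqVlt [(z <= y)%O]le_eqVlt [x == z]eq_sym.
  case: (z =P x) => [->|_]; first by rewrite xy orbT.
  by case: (z =P y) => [->|_]; rewrite ?xy //= andbb.
rewrite (perm_big _ Es) !big_cons /= addrA addrAC; congr (_ + _ + _).
rewrite !big_filter_cond /=.
transitivity (\sum_(z <- vertices_upto F (rank y)
                   | (rank x < rank z < rank y)%N) a (rank z)).
  apply: eq_big => [z|z /and3P[_ /ba]//].
  rewrite andbT -!cobweb_ltE; apply/andb_idl.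
  by case/andP=> /ltW -> /ltW ->.
rewrite (sum_vertices_upto _ (fun i => rank x < i < rank y)%N).
rewrite [RHS](big_nat_widenl _ 0%N) // [RHS](big_nat_widen _ _ (rank y).+1) //=.
(* The lower bound excludes [i = 0]; at successors [level_size] computes to [F]. *)
by apply: eq_big => [|[]].
Qed.

(** Distinct vertices of equal rank are incomparable, so among pairs [x <= y] the diagonal is the
    only case outside [x < y]; it gets its own value [d]. *)
Definition ranked d u f : Prop :=
  (forall x, f x x = d) /\
  (forall x y, (x < y)%O -> f x y = u (rank x) (rank y)).

(* Since i > k >= 0, the exceptional level 0 never contributes and F i is the
   level size. *)
Definition ranked_mul d u e v k n : R :=
  d * v k n + \sum_(k.+1 <= i < n) (u k i * v i n) *+ F i + u k n * e.

Lemma conv_ranked d u f e v g : ranked d u f -> ranked e v g ->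
  ranked (d * e) (ranked_mul d u e v) (conv f g).
Proof.
move=> [fd fu] [ge gv]; split=> [x|x y xy].
  by rewrite /conv segmentxx big_seq1 fd ge.
rewrite /conv (@sum_segment _ _ _ (fun i => u (rank x) i * v i (rank y))) //.
  by rewrite fd ge fu // gv.
by move=> z /andP[xz zy]; rewrite fu // gv.
Qed.

Lemma eq_ranked d u v f : (forall k n, (k < n)%N -> u k n = v k n) ->
  ranked d u f -> ranked d v f.
Proof.
move=> uv [fd fu]; split=> // x y xy.
by rewrite fu // uv // -cobweb_ltE.
Qed.

Lemma conv_incidence f g : incidence (conv f g).
Proof.
move=> x y xy; rewrite /conv big_seq big1 // => z.
by rewrite mem_segment => /andP[xz zy]; rewrite (le_trans xz zy) in xy.
Qed.

(** * The basic functions and their powers *)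

Lemma ranked_delta : ranked 1 (fun _ _ => 0) (delta R F).
Proof. by rewrite /delta; split=> [x|x y /lt_eqF ->]; rewrite ?eqxx. Qed.

Lemma ranked_zeta : ranked 1 (fun _ _ => 1) (zeta R F).
Proof. by rewrite /zeta; split=> [x|x y /ltW ->]; rewrite ?lexx. Qed.

Lemma ranked_eta : ranked 0 (fun _ _ => 1) (eta R F).
Proof.
have [[d1 d2] [z1 z2]] := (ranked_delta, ranked_zeta).
rewrite /eta; split=> [x|x y xy]; first by rewrite d1 z1 subrr.
by rewrite d2 // z2 // subr0.
Qed.

Lemma ranked_calC : ranked 1 (fun _ _ => -1) (calC R F).
Proof.
have [[d1 d2] [e1 e2]] := (ranked_delta, ranked_eta).
rewrite /calC; split=> [x|x y xy]; first by rewrite d1 e1 subr0.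
by rewrite d2 // e2 // sub0r.
Qed.

Lemma ranked_chi : ranked 0 (fun k n => (k.+1 == n)%:R) (chi R F).
Proof. by split=> // x; rewrite /chi gtn_eqF. Qed.

(** Powers start from [delta], so the first power is [conv f delta] rather than [f] itself. *)
Lemma ranked_conv_pow1 u f : ranked 0 u f -> ranked 0 u (conv_pow f 1).
Proof.
move=> fu; have := conv_ranked fu ranked_delta.
rewrite mul0r; apply: eq_ranked => k n _.
rewrite /ranked_mul /= mul0r mulr1 add0r.
by rewrite big1 ?add0r // => i _; rewrite mulr0 mul0rn.
Qed.

(** A zero diagonal kills both end terms of the convolution, leaving only the vertices strictly in
    between. *)
Lemma ranked_conv_powS u v f s : ranked 0 u f -> ranked 0 v (conv_pow f s) ->
  ranked 0 (fun k n => \sum_(k.+1 <= i < n) (u k i * v i n) *+ F i)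
    (conv_pow f s.+1).
Proof.
move=> fu fv; have := conv_ranked fu fv.
rewrite mul0r; apply: eq_ranked => k n _.
by rewrite /ranked_mul /= mul0r mulr0 add0r addr0.
Qed.

Lemma ranked_zeta2 :
  ranked 1 (fun k n => \sum_(k.+1 <= i < n) (F i)%:R + 2%:R)
    (conv_pow (zeta R F) 2).
Proof.
have z1 : ranked 1 (fun _ _ => 1) (conv_pow (zeta R F) 1).
  have := conv_ranked ranked_zeta ranked_delta.
  rewrite mul1r; apply: eq_ranked => k n _.
  rewrite /ranked_mul /= mulr0 mulr1 add0r.
  by rewrite big1 ?add0r // => i _; rewrite mul0rn.
have := conv_ranked ranked_zeta z1.
rewrite mul1r; apply: eq_ranked => k n _; rewrite /ranked_mul /= mulr1.
by rewrite addrAC addrC.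
Qed.

(** A tuple lists [s] interior ranks [k < i_1 < ... < i_s < n], so this is the value of the power
    [s.+1] of [eta]; the [rcons] supplies the last inequality. *)
Definition chain_sum s k n : R :=
  \sum_(t : s.-tuple 'I_n | path ltn k (rcons [seq val i | i <- t] n))
    \prod_(i <- t) (F i)%:R.

Lemma chain_sum0 k n : chain_sum 0 k n = (k < n)%N%:R.
Proof.
transitivity (\sum_(t : 0.-tuple 'I_n) (k < n)%N%:R : R).
  rewrite /chain_sum big_mkcond; apply: eq_bigr => t _.
  by rewrite tuple0 /= andbT big_nil; case: (k < n)%N.
by rewrite big_const card_tuple expn0 /= addr0.
Qed.

(** Chains are sorted by their smallest rank: head and tail identify a tuple with its first index
    and a shorter chain above it. *)
Lemma chain_sumS s k n :
  chain_sum s.+1 k n = \sum_(k.+1 <= i < n) (F i)%:R * chain_sum s i n.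
Proof.
rewrite big_geq_mkord /chain_sum.
under [RHS]eq_bigr do rewrite big_distrr /=.
rewrite pair_big_dep /=.
rewrite (reindex (fun p : 'I_n * s.-tuple 'I_n => [tuple of p.1 :: p.2])) /=.
  by apply: eq_bigr => p _; rewrite big_cons.
exists (fun t => (thead t, [tuple of behead t])) => [[i t] _|t _] /=.
  by congr (_, _); apply/val_inj.
by rewrite [RHS]tuple_eta.
Qed.

Lemma ranked_eta_pow s :
  ranked 0 (chain_sum s) (conv_pow (eta R F) s.+1).
Proof.
elim: s => [|s IHs].
  apply: eq_ranked (ranked_conv_pow1 ranked_eta) => k n kn.
  by rewrite chain_sum0 kn.
apply: eq_ranked (ranked_conv_powS ranked_eta IHs) => k n _.
by rewrite chain_sumS; apply: eq_bigr => i _; rewrite mul1r mulr_natl.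
Qed.

Lemma ranked_chi_pow s :
  ranked 0 (fun k n => (k + s.+1 == n)%N%:R * \prod_(k.+1 <= i < n) (F i)%:R)
    (conv_pow (chi R F) s.+1).
Proof.
elim: s => [|s IHs].
  apply: eq_ranked (ranked_conv_pow1 ranked_chi) => k n kn.
  by rewrite addn1; case: eqP => [<-|_]; rewrite ?mul0r // big_geq // mulr1.
apply: eq_ranked (ranked_conv_powS ranked_chi IHs) => k n kn.
(* If [n <= k.+1], the sum is empty and [k + s.+2] exceeds [n]. *)
have [kn1|nk1] := ltnP k.+1 n; last first.
  rewrite [LHS]big_geq // !addnS gtn_eqF ?mul0r //.
  by rewrite ltnS (leq_trans nk1) // ltnS leq_addr.
(* The factor [chi] starting at rank [k] leaves only the term [i = k.+1]. *)
rewrite [LHS]big_ltn // [X in _ + X]big_nat [X in _ + X]big1.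
  rewrite addr0 eqxx mul1r addSnnS -mulr_natl [in RHS]big_ltn //.
  by case: eqP; rewrite ?mul0r ?mulr0 ?mul1r.
by move=> i /andP[ki _]; rewrite ltn_eqF // mul0r mul0rn.
Qed.

(** * The Moebius function *)

Definition moebius k n : R :=
  (-1) ^+ (n - k) * \prod_(k.+1 <= i < n) ((F i)%:R - 1).

Lemma moebiusSr k n : (k < n)%N ->
  moebius k n.+1 = moebius k n - moebius k n *+ F n.
Proof.
move=> kn; rewrite /moebius subSn 1?ltnW // big_nat_recr //= exprS mulN1r mulNr.
by rewrite mulrA mulrBr mulr1 mulr_natr opprB.
Qed.

Lemma moebiusSl k n : (k.+1 < n)%N ->
  moebius k n = moebius k.+1 n - moebius k.+1 n *+ F k.+1.
Proof.
move=> kn; rewrite /moebius -[(n - k)%N]prednK ?subn_gt0 1?ltnW //.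
(* [R] may be noncommutative: the factor of rank [k.+1] is moved left past the sign, which is
   central. *)
rewrite -subnS big_ltn // exprS mulN1r mulNr mulrA -commr_sign -mulrA.
by rewrite mulrBl mul1r mulr_natl opprB.
Qed.

(** This makes [conv mu zeta] vanish off the diagonal: raising [n] adds [moebius k n *+ F n] to the
    sum, and [moebiusSr] subtracts the same from the last term. *)
Lemma moebius_recr k n : (k < n)%N ->
  1 + \sum_(k.+1 <= i < n) moebius k i *+ F i + moebius k n = 0.
Proof.
elim: n => // n IHn; rewrite ltnS leq_eqVlt => /predU1P[<-|kn].
  by rewrite big_geq // /moebius subSnn big_geq // mulr1 addr0 subrr.
rewrite big_nat_recr //= moebiusSr //.
by rewrite [1 + (_ + _)]addrA addrACA subrr addr0 IHn.
Qed.

(** The mirror image, for [conv zeta mu]: the top rank stays fixed, [k] descends, and [moebiusSl]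
    cancels the new lowest term. *)
Lemma moebius_recl k n : (k < n)%N ->
  moebius k n + \sum_(k.+1 <= i < n) moebius i n *+ F i + 1 = 0.
Proof.
move=> kn; rewrite -(subnKC kn); move: (n - k.+1)%N => m {kn}.
elim: m k => [|m IHm] k.
  by rewrite addn0 big_geq // /moebius subSnn big_geq // mulr1 addr0 addNr.
have km : (k.+1 < k.+1 + m.+1)%N by rewrite -addSnnS leq_addr.
by rewrite big_ltn // moebiusSl // addrA subrK -addSnnS IHm.
Qed.

(** At [x < y] the equation for [conv mu zeta] determines [mu x y] from the values [mu x z] with
    [x <= z < y]. Strong induction on the rank of [y] identifies these, and [moebius] satisfies the
    same recurrence. *)
Lemma ranked_zeta_inv mu : conv_inverse (zeta R F) mu -> ranked 1 moebius mu.
Proof.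
move=> [_ _ mulz]; have [z1 z2] := ranked_zeta; have [d1 d2] := ranked_delta.
have mu1 x : mu x x = 1.
  by have := mulz x x; rewrite /conv segmentxx big_seq1 z1 mulr1 d1.
split=> // x y; have [m] := ubnP (rank y); elim: m y => // m IHm y ym xy.
have := mulz x y; rewrite /conv d2 // (@sum_segment _ _ _ (moebius (rank x))) //.
  rewrite z1 z2 // mu1 !mulr1 => /eqP; rewrite addrC addr_eq0 => /eqP->.
  by apply/eqP; rewrite eq_sym -addr_eq0 addrC moebius_recr // -cobweb_ltE.
move=> z /andP[xz zy]; rewrite z2 // mulr1 IHm //.
by rewrite -ltnS (leq_trans _ ym) // ltnS -cobweb_ltE.
Qed.

(** [ranked] controls comparable pairs only; [incidence] supplies the zeros elsewhere. *)
Lemma eq_delta f : incidence f -> ranked 1 (fun _ _ => 0) f -> f =2 delta R F.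
Proof.
move=> f0 [f1 f2] x y; have [d1 d2] := ranked_delta.
have [|xy] := boolP (x <= y)%O; last first.
  by rewrite f0 // /delta; case: eqP xy => // ->; rewrite lexx.
by rewrite le_eqVlt => /predU1P[<-|xy]; rewrite ?f1 ?d1 // f2 ?d2.
Qed.

Lemma zeta_inv_exists : exists mu, conv_inverse (zeta R F) mu.
Proof.
(* Outside [x < y] the Kronecker value is 1 on the diagonal and 0 elsewhere, which puts [mu] in the
   incidence algebra. *)
pose mu x y := if (x < y)%O then moebius (rank x) (rank y) else (x == y)%:R.
have mur : ranked 1 moebius mu.
  by split=> [x|x y]; rewrite /mu ?ltxx ?eqxx // => ->.
exists mu; split=> [x y xy||].
- by rewrite /mu; move: xy; rewrite le_eqVlt negb_or => /andP[/negPf-> /negPf->].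
- apply: eq_delta; first exact: conv_incidence.
  have := conv_ranked ranked_zeta mur.
  rewrite mul1r; apply: eq_ranked => k n kn; rewrite /ranked_mul /= !mul1r.
  by under eq_bigr do rewrite mul1r; rewrite moebius_recl.
- apply: eq_delta; first exact: conv_incidence.
  have := conv_ranked mur ranked_zeta.
  rewrite mul1r; apply: eq_ranked => k n kn; rewrite /ranked_mul /= !mulr1.
  by under eq_bigr do rewrite mulr1; rewrite moebius_recr.
Qed.

(** * From ranked functions to values on a type *)

Lemma ranked_type_value d u f k n r :
    (forall i, (0 < i)%N -> (0 < F i)%N) -> ranked d u f ->
    r = (if (k < n)%N then u k n else if k == n then d else 0) ->
  type_value f k n r.
Proof.
move=> Fpos [fd fu] ->; rewrite /type_value.
(* Every level has a vertex with first coordinate 1: by positivity of [F] above level 0, and as the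
   root at level 0, even when [F 0 = 0]. *)
have lvl i : (1 <= 1 <= level_size F i)%N.
  rewrite /level_size; case: i => [|i] /=; last exact: Fpos.
  by case: eqP => // /eqP; rewrite lt0n.
case: ltngtP => // [kn|kn]; split.
- exists (@Vertex F (1%N, k) (lvl k)), (@Vertex F (1%N, n) (lvl n)).
  by rewrite /of_type [(_ <= _)%O]cobweb_leE /rank /= kn !eqxx.
- by move=> x y /and3P[_ /eqP xk /eqP yn]; rewrite fu ?cobweb_ltE xk yn.
- exists (@Vertex F (1%N, k) (lvl k)), (@Vertex F (1%N, k) (lvl k)).
  by rewrite /of_type lexx /rank /= -kn eqxx.
(* Comparable vertices of equal rank coincide, so the common value is [d]. *)
- move=> x y /and3P[]; rewrite [(x <= y)%O]cobweb_leE => + /eqP xk /eqP yn.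
  by rewrite xk yn kn ltnn => /eqP ->.
Qed.

End RankedFunctions.

Theorem corollary1 (R : pzRingType) (F : nat -> nat)
    (F0 : F 0%N = 1%N \/ F 0%N = 0%N)
    (Fpos : forall i : nat, (0 < i)%N -> (0 < F i)%N)
    (k n s : nat) (s_gt0 : (0 < s)%N) :
  type_value (zeta R F) k n (if (k <= n)%N then 1 else 0) /\
  type_value (conv_pow (zeta R F) 2) k n
    (if (k < n)%N then (\sum_(k.+1 <= i < n) (F i)%:R) + 2%:R
     else if k == n then 1 else 0) /\
  type_value (eta R F) k n (if (k < n)%N then 1 else 0) /\
  type_value (conv_pow (eta R F) 2) k n
    (if (k <= n)%N then \sum_(k.+1 <= i < n) (F i)%:R else 0) /\
  type_value (conv_pow (eta R F) s) k n
    (if (k <= n)%N then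
       \sum_(t : (s.-1).-tuple 'I_n
               | path ltn k (rcons [seq val i | i <- t] n))
          \prod_(i <- t) (F i)%:R
     else 0) /\
  type_value (calC R F) k n
    (if k == n then 1 else if (k < n)%N then -1 else 0) /\
  type_value (chi R F) k n (k.+1 == n)%:R /\
  type_value (conv_pow (chi R F) s) k n
    ((k + s == n)%N%:R * \prod_(k.+1 <= i < n) (F i)%:R) /\
  ((exists mu, conv_inverse (zeta R F) mu) /\
   (forall mu, conv_inverse (zeta R F) mu ->
      type_value mu k n
        (if (k <= n)%N then
           (-1) ^+ (n - k) * \prod_(k.+1 <= i < n) ((F i)%:R - 1)
         else 0))).
Proof.
have tv := fun d u f r => @ranked_type_value R F d u f k n r Fpos.
have eta_pow m : type_value (conv_pow (eta R F) m.+1) k n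
    (if (k <= n)%N then @chain_sum R F m k n else 0).
  apply: tv (ranked_eta_pow m) _; case: ltngtP => // ->.
  (* At [k = n] no strict chain leads from [k] to [n], so the sum is empty and agrees with the
     diagonal value 0. *)
  rewrite /chain_sum big_pred0 // => t; apply/negP.
  by rewrite (path_sortedE ltn_trans) all_rcons /= ltnn.
split; first by apply: tv ranked_zeta _; case: ltngtP.
(* At [k = n] the segment is a single vertex and the square is 1, whereas the formula for [k < n]
   would give 2 there. *)
split; first exact: tv ranked_zeta2 _.
split; first by apply: tv ranked_eta _; case: ltngtP.
split.
  have <- : @chain_sum R F 1 k n = \sum_(k.+1 <= i < n) (F i)%:R :> R.
    rewrite chain_sumS; apply: eq_big_nat => i /andP[_ lt_in].
    by rewrite chain_sum0 lt_in mulr1.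
  exact: eta_pow.
split; first by have := eta_pow s.-1; rewrite prednK.
split; first by apply: tv ranked_calC _; case: ltngtP.
split.
  apply: tv ranked_chi _; case: ltngtP => // [nk|->]; last by rewrite gtn_eqF.
  by rewrite gtn_eqF // ltnW.
split.
  have := @ranked_chi_pow R F s.-1; rewrite prednK // => chis; apply: tv chis _.
  (* If [n <= k], then [s > 0] puts [k + s] above [n]. *)
  have [//|nk] := ltnP k n; rewrite gtn_eqF ?mul0r; first by case: eqP.
  by rewrite (leq_ltn_trans nk) // -addn1 leq_add2l.
split; first exact: zeta_inv_exists.
move=> mu /ranked_zeta_inv mur; apply: tv mur _.
(* At [k = n] the zero exponent and the empty product give the diagonal value 1. *)
by case: ltngtP => // ->; rewrite subnn big_geq // mulr1.
Qed.
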